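(* Let $p$ be a prime and let $r$ be a positive integer with $p^r>2$. Then for $|x|<1$, $$\sum_{n=1}^{\infty}Q_{p^r}(n)x^n=\frac{x^{p^r}}{(1-x^2)\left(1-x^{2(p^r-1)} \right) }-\frac{x^{p^r}}{1-x^{2p^r}}.$$
   Context: For positive integers $n,k$, $Q_k(n)$ denotes the number of tuples $(t_1,t_2,\ldots,t_{\lceil n/2\rceil})$ of nonnegative integers with $\sum_{i=1}^{\lceil n/2\rceil}(2i-1)t_i=n$ (i.e. partitions of $n$ into odd parts, where $t_i$ is the multiplicity of the part $2i-1$) such that the multinomial coefficient $\binom{t_1+\cdots+t_{\lceil n/2\rceil}}{t_1,\ldots,t_{\lceil n/2\rceil}}=\frac{(t_1+\cdots+t_{\lceil n/2\rceil})!}{t_1!\cdots t_{\lceil n/2\rceil}!}$ equals $k$. *)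

(* Defs.v *)
From mathcomp Require Export all_boot all_order all_algebra.
From mathcomp Require Export finmap.
From mathcomp Require Export all_classical all_reals all_analysis.
From mathcomp Require Export complex.

Set Implicit Arguments.
Unset Strict Implicit.
Unset Printing Implicit Defensive.

Import Order.TTheory GRing.Theory Num.Theory.
Export numFieldNormedType.Exports.

Local Open Scope nat_scope.
Local Open Scope classical_set_scope.

Definition multinomial (m : nat) (t : {ffun 'I_m -> nat}) : nat :=
  (\sum_i t i)`! %/ \prod_i (t i)`!.

(* The truncated division in [multinomial] is exact. *)
Lemma multinomial_dvd (m : nat) (t : {ffun 'I_m -> nat}) :
  \prod_i (t i)`! %| (\sum_i t i)`!.
Proof.
apply: (big_ind2 (fun P s => P %| s`!)) => // P1 s1 P2 s2 h1 h2.
apply: dvdn_trans (dvdn_mul h1 h2) _.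
by rewrite -(bin_fact (leq_addr s2 s1)) addKn dvdn_mull.
Qed.

(* The index [i : 'I_(uphalf n)] starts at 0, so the part with multiplicity
   [t i] is [2 * i + 1]; [uphalf n] is the ceiling of [n / 2]. *)
Definition odd_partitions_multinomial (k n : nat) :
    set {ffun 'I_(uphalf n) -> nat} :=
  [set t : {ffun 'I_(uphalf n) -> nat} |
    \sum_(i < uphalf n) (2 * i + 1) * t i = n /\ multinomial t = k].

Arguments odd_partitions_multinomial : clear implicits.

Definition Q (k n : nat) : nat :=
  #|` fset_set (odd_partitions_multinomial k n)|%fset.

(* [fset_set] is the empty set on infinite sets; this case does not occur. *)
Lemma finite_odd_partitions_multinomial (k n : nat) :
  finite_set (odd_partitions_multinomial k n).
Proof.
pose f (u : {ffun 'I_(uphalf n) -> 'I_n.+1}) := [ffun i => u i : nat].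
apply: (@sub_finite_set _ _ (range f)); last first.
  by apply: finite_image; exact: finite_finset.
move=> t [tn _]; exists [ffun i => inord (t i)] => //.
apply/ffunP => i; rewrite !ffunE inordK // ltnS -[leqRHS]tn (bigD1 i) //=.
by rewrite (leq_trans _ (leq_addr _ _)) // leq_pmull // addn1.
Qed.

(* Main.v *)
Require Import Defs.
From mathcomp Require Import all_boot all_order all_algebra.
From mathcomp Require Import all_classical all_reals all_analysis.
From mathcomp Require Import complex.
From mathcomp Require Import zify ring.

(* A prime power dividing C(n, k) is at most n, whereas C(n, k) > n when
   2 <= k <= n - 2; hence C(n, k) is a prime power only for k = 1 or k = n - 1.
   A multinomial coefficient is divisible by C(s, t_j), where s is the sum of the
   t_i, so it equals q = p^r > 2 exactly when the nonzero multiplicities are 1 and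
   q - 1.  Thus Q_q(n) counts the pairs of distinct odd numbers u, v with
   u + (q - 1) v = n.  The odd multiples of d have generating function
   x^d / (1 - x^(2 d)); the result is the product of those for d = 1 and d = q - 1,
   minus the one for d = q, which accounts for u = v. *)

Set Implicit Arguments.
Unset Strict Implicit.
Unset Printing Implicit Defensive.

Import Order.TTheory GRing.Theory Num.Theory.

Local Open Scope nat_scope.

Lemma logn_fact_upto (p n m : nat) : prime p -> n < p ^ m.+1 ->
  logn p n`! = \sum_(1 <= k < m.+1) n %/ p ^ k.
Proof.
move=> pp nm; have p1 := prime_gt1 pp; rewrite logn_fact //.
have trailing_zeros a b : a <= b -> n < p ^ a.+1 ->
    \sum_(1 <= k < b.+1) n %/ p ^ k = \sum_(1 <= k < a.+1) n %/ p ^ k.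
  move=> ab na; rewrite (@big_cat_nat _ _ _ a.+1) //=.
  rewrite [X in _ + X]big_nat_cond [X in _ + X]big1 ?addn0 // => k /andP[/andP[ak _] _].
  by rewrite divn_small // (leq_trans na) // leq_exp2l.
case/orP: (leq_total m n) => mn; first exact: trailing_zeros.
by rewrite -(trailing_zeros _ _ mn) // (ltn_trans (ltnSn n)) // ltn_expl.
Qed.

(* Kummer's theorem: each summand is the carry into position [k] when [i] and
   [j] are added in base [p]. *)
Lemma logn_bin (p i j m : nat) : prime p -> i + j < p ^ m.+1 ->
  logn p 'C(i + j, i) = \sum_(1 <= k < m.+1) (p ^ k <= i %% p ^ k + j %% p ^ k).
Proof.
move=> pp ijm; have := congr1 (logn p) (bin_fact (leq_addr j i)); rewrite addKn.
rewrite !lognM ?muln_gt0 ?fact_gt0 ?bin_gt0 ?leq_addr //.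
rewrite !(@logn_fact_upto p _ m) ?(leq_ltn_trans _ ijm) ?leq_addr ?leq_addl //.
under [RHS]eq_bigr do rewrite divnD ?expn_gt0 ?prime_gt0 //.
by rewrite !big_split /= addnC => /addnI.
Qed.

Lemma pfactor_logn_bin_leq (p n k : nat) : prime p -> 0 < n ->
  p ^ logn p 'C(n, k) <= n.
Proof.
move=> pp n0; have [nk|kn] := ltnP n k; first by rewrite bin_small ?logn0.
have p1 := prime_gt1 pp; apply: leq_trans (trunc_logP p1 n0).
rewrite leq_exp2l // -[in 'C(n, k)](subnKC kn).
rewrite (@logn_bin _ _ _ (trunc_log p n)) ?subnKC ?trunc_log_ltn //.
apply: (@leq_trans (\sum_(1 <= j < (trunc_log p n).+1) 1)).
  by apply: leq_sum => j _; exact: leq_b1.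
by rewrite sum_nat_const_nat subn1 muln1.
Qed.

Lemma leq_bin (n k : nat) : 0 < k < n -> n <= 'C(n, k).
Proof.
elim: n k => // n IH [|k] //=; rewrite ltnS leq_eqVlt binS => /orP[/eqP <-|kn].
  by rewrite binn binSn.
by rewrite -addn1 leq_add ?IH // bin_gt0 ltnW // ltnW.
Qed.

Lemma ltn_bin (n k : nat) : 1 < k < n.-1 -> n < 'C(n, k).
Proof.
case: n k => [|n] [|[|k]] //= kn; rewrite binS.
by have := @leq_bin n k.+1; have := @leq_bin n k.+2; lia.
Qed.

Lemma bin_eq_prime_power (p e n k : nat) : prime p -> 0 < k < n ->
  'C(n, k) = p ^ e -> k = 1 \/ k = n.-1.
Proof.
move=> pp kn binE; have n0 : 0 < n by lia.
have := pfactor_logn_bin_leq k pp n0; rewrite binE pfactorK // -binE.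
by have := @ltn_bin n k; lia.
Qed.

Lemma fact_eq_prime_power_leq2 (p e n : nat) : prime p -> n`! = p ^ e -> n <= 2.
Proof.
move=> pp nE; rewrite leqNgt; apply/negP => n2.
have eq_p d : prime d -> d <= n -> d = p.
  move=> dp dn; apply/eqP; rewrite -(dvdn_prime2 dp pp).
  have : d %| p ^ e by rewrite -nE dvdn_fact // prime_gt0.
  by rewrite Euclid_dvdX // => /andP[].
by have := eq_p 2 isT (ltnW n2); rewrite -(eq_p 3).
Qed.

Section Multinomial.

Variable m : nat.
Implicit Types (t : {ffun 'I_m -> nat}) (i j : 'I_m).

Lemma multinomial_fact t : multinomial t * \prod_i (t i)`! = (\sum_i t i)`!.
Proof. by rewrite divnK // multinomial_dvd. Qed.

Lemma multinomial_le1 t : (forall i, t i <= 1) -> multinomial t = (\sum_i t i)`!.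
Proof.
move=> t1; rewrite -multinomial_fact big1 ?muln1 // => i _.
by case: (t i) (t1 i) => [|[]].
Qed.

Lemma multinomial_bin t j :
  multinomial t =
  'C(\sum_i t i, t j) * multinomial [ffun i => if i == j then 0 else t i].
Proof.
set t' := [ffun i => _]; set s := \sum_(i | i != j) t i.
have t'E i : i != j -> t' i = t i by rewrite ffunE => /negPf ->.
have t'j : t' j = 0 by rewrite ffunE eqxx.
have t'_fact : multinomial t' * \prod_(i | i != j) (t i)`! = s`!.
  have := multinomial_fact t'; rewrite (bigD1 j) //= [in RHS](bigD1 j) //=.
  rewrite t'j fact0 mul1n add0n (eq_bigr _ t'E).
  by under eq_bigr => i ij do rewrite t'E //.
have := multinomial_fact t; rewrite (bigD1 j) //= [\sum_i t i](bigD1 j) //=.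
rewrite -/s -(bin_fact (leq_addr s (t j))) addKn -t'_fact => multE.
apply/eqP; rewrite -(@eqn_pmul2r ((t j)`! * \prod_(i | i != j) (t i)`!)).
  by apply/eqP; rewrite multE; ring.
by rewrite muln_gt0 fact_gt0 prodn_gt0 // => i; exact: fact_gt0.
Qed.

Definition two_parts i a j b : {ffun 'I_m -> nat} :=
  [ffun k => if k == i then a else if k == j then b else 0].

Lemma big_two_parts (T : Type) (idx : T) (op : Monoid.com_law idx) i a j b
    (F : 'I_m -> nat -> T) : i != j -> (forall k, F k 0 = idx) ->
  \big[op/idx]_k F k (two_parts i a j b k) = op (F i a) (F j b).
Proof.
move=> ij F0; rewrite (bigD1 i) //= (bigD1 j) 1?eq_sym //= !ffunE eqxx.
rewrite [j == i]eq_sym (negPf ij) eqxx big1 ?Monoid.mulm1 // => k /andP[ki kj].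
by rewrite ffunE (negPf ki) (negPf kj).
Qed.

Lemma multinomial_two_parts i a j b : i != j ->
  multinomial (two_parts i a j b) = 'C(a + b, a).
Proof.
move=> ij; rewrite /multinomial.
rewrite (big_two_parts addn _ _ (F := fun=> id)) //.
rewrite (big_two_parts muln _ _ (F := fun=> factorial)) //=.
by rewrite -(bin_fact (leq_addr b a)) addKn mulnK // muln_gt0 !fact_gt0.
Qed.

Lemma two_parts_inj i a j b i' j' : 0 < a -> 0 < b -> a != b -> i != j -> i' != j' ->
  two_parts i a j b = two_parts i' a j' b -> (i, j) = (i', j').
Proof.
move=> a0 b0 ab ij ij' /ffunP two_partsE.
have ii' : i = i'.
  by have := two_partsE i; rewrite !ffunE eqxx; case: eqP => // _; case: eqP; lia.
rewrite -ii' in ij' two_partsE *; congr (_, _).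
have := two_partsE j; rewrite !ffunE [j == i]eq_sym (negPf ij) eqxx.
by case: eqP => // _; lia.
Qed.

Lemma multinomial_single_part t j :
  \sum_(i | i != j) t i = 0 -> multinomial t = 1.
Proof.
move=> /eqP; rewrite sum_nat_eq0 => /forall_inP t0.
rewrite /multinomial (bigD1 j) // [X in _ %/ X](bigD1 j) //=.
rewrite !big1 => [|i /t0/eqP-> //|i /t0/eqP-> //].
by rewrite addn0 muln1 divnn fact_gt0.
Qed.

Lemma multinomial_eq_prime_power (p r : nat) t :
  prime p -> 2 < p ^ r -> multinomial t = p ^ r ->
  exists i j, i != j /\ t = two_parts i 1 j (p ^ r).-1.
Proof.
move=> pp q2 multE.
have [/forallP/multinomial_le1 factE|] := boolP [forall j, t j <= 1].
  have := fact_eq_prime_power_leq2 pp (etrans (esym factE) multE).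
  by move: q2; rewrite -multE factE; case: (\sum_i t i) => [|[|[]]].
rewrite negb_forall => /existsP[j]; rewrite -ltnNge => tj.
have sumE : \sum_i t i = t j + \sum_(i | i != j) t i by rewrite (bigD1 j).
have [/multinomial_single_part|other_gt0] := posnP (\sum_(i | i != j) t i).
  by rewrite multE; lia.
have /(dvdn_pfactor _ _ pp)[e _ binE] : 'C(\sum_i t i, t j) %| p ^ r.
  by rewrite -multE (multinomial_bin t j) dvdn_mulr.
have [|tj1|tjE] := bin_eq_prime_power pp _ binE; [lia | lia |].
have /eqP/sum_nat_eq1[i [ij ti t0]] : \sum_(i | i != j) t i = 1 by lia.
have tE : t = two_parts i 1 j (t j).
  apply/ffunP => k; rewrite ffunE; case: eqP => [->//|/eqP ki].
  by case: eqP => [->//|/eqP kj]; rewrite t0.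
exists i, j; split => //; rewrite [LHS]tE; congr two_parts.
by rewrite -multE [in RHS]tE multinomial_two_parts // bin1.
Qed.

End Multinomial.

Definition odd_multiple (d n : nat) : bool := (d %| n) && odd (n %/ d).

Lemma odd_multipleP (d n : nat) : 0 < d ->
  reflect (exists c, d * (2 * c + 1) = n) (odd_multiple d n).
Proof.
move=> d0; apply: (iffP andP) => [[dn odd_q]|[c <-]].
  by exists (n %/ d)./2; rewrite -[RHS](divnK dn) mulnC; congr (_ * _); lia.
by rewrite dvdn_mulr // mulKn //; lia.
Qed.

Lemma odd_multipleDl (d n : nat) : 0 < d ->
  odd_multiple d (n + 2 * d) = odd_multiple d n.
Proof.
move=> d0; rewrite /odd_multiple dvdn_addl ?dvdn_mull //.
by rewrite divnDMl // oddD addbF.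
Qed.

Lemma odd_multiple_lt (d n : nat) : n < 2 * d -> odd_multiple d n = (n == d).
Proof.
move=> nd; have d0 : 0 < d by lia.
apply/(odd_multipleP _ d0)/eqP => [[[|c] cE]|->]; [nia | nia |].
by exists 0; rewrite muln1.
Qed.

Lemma sum_odd_multiples (d n m : nat) : 0 < d -> uphalf n <= m ->
  \sum_(i < m) (d * (2 * i + 1) == n) = odd_multiple d n.
Proof.
move=> d0 nm; have [[c cE]|no_c] := odd_multipleP n d0; last first.
  by rewrite big1 // => i _; case: eqP => // iE; case: no_c; exists i.
have cm : c < m by nia.
rewrite (bigD1 (Ordinal cm)) //= cE eqxx big1 // => i.
by rewrite -val_eqE => /= ic; apply/eqP; rewrite eqb0; nia.
Qed.

Definition odd_pair_size (q i j : nat) : nat := 2 * i + 1 + q.-1 * (2 * j + 1).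

Lemma sum_odd_parts_two_parts (q m : nat) (i j : 'I_m) : i != j ->
  \sum_(k < m) (2 * k + 1) * two_parts i 1 j q.-1 k = odd_pair_size q i j.
Proof.
move=> ij; rewrite (big_two_parts addn _ _ (F := fun k a => (2 * k + 1) * a)) //=.
  by rewrite muln1 [_ * q.-1]mulnC.
by move=> k; rewrite muln0.
Qed.

Lemma odd_partitions_prime_powerP (p r n : nat) (t : {ffun 'I_(uphalf n) -> nat}) :
  prime p -> 2 < p ^ r ->
  odd_partitions_multinomial (p ^ r) n t <->
  exists i j : 'I_(uphalf n), [/\ i != j, odd_pair_size (p ^ r) i j = n
    & t = two_parts i 1 j (p ^ r).-1].
Proof.
move=> pp q2.
split=> [[size_t /(multinomial_eq_prime_power pp q2)[i [j [ij tE]]]]|].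
  by exists i, j; rewrite -sum_odd_parts_two_parts // -tE.
move=> [i [j [ij size_ij ->]]]; split; first by rewrite sum_odd_parts_two_parts.
by rewrite multinomial_two_parts // bin1; lia.
Qed.

Lemma Q_prime_power_ordered_pairs (p r n : nat) : prime p -> 2 < p ^ r ->
  Q (p ^ r) n = \sum_(i < uphalf n) \sum_(j < uphalf n)
    ((i != j) && (odd_pair_size (p ^ r) i j == n)).
Proof.
move=> pp q2; pose D := [pred u : 'I_(uphalf n) * 'I_(uphalf n) |
  (u.1 != u.2) && (odd_pair_size (p ^ r) u.1 u.2 == n)].
have -> : Q (p ^ r) n = #|` [fset two_parts u.1 1 u.2 (p ^ r).-1 | u in D]|%fset.
  congr #|` _|%fset; apply/fsetP => t.
  rewrite in_fset_set; last exact: finite_odd_partitions_multinomial.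
  apply/idP/imfsetP => [|[[i j] /andP[/= ij /eqP size_ij] ->]].
    rewrite inE => /(odd_partitions_prime_powerP _ pp q2)[i [j [ij size_ij ->]]].
    by exists (i, j); rewrite //= inE /= ij size_ij /=.
  by apply: mem_set; apply/odd_partitions_prime_powerP => //; exists i, j.
rewrite card_in_imfset /= -?cardE => [|[i j] [i' j'] /andP[ij _] /andP[ij' _]].
  rewrite -sum1_card big_mkcond pair_bigA; apply: eq_bigr => u _.
  by rewrite inE; case: (_ && _).
by apply: two_parts_inj => //; lia.
Qed.

Lemma eqn_add_sum (u v n : nat) :
  ((u + v == n) : nat) = \sum_(k < n.+1) (u == k) * (v == n - k).
Proof.
have [un|nu] := leqP u n; last first.
  rewrite big1 => [|k _]; last by rewrite gtn_eqF // (leq_ltn_trans _ nu) // -ltnS.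
  by rewrite gtn_eqF // ltn_addr.
rewrite (bigD1 (Ordinal (un : u < n.+1))) //= eqxx mul1n big1 ?addn0 => [|k].
  by congr nat_of_bool; lia.
by rewrite -val_eqE /= eq_sym => /negPf ->.
Qed.

(* The term [odd_multiple (p ^ r) n] restores the diagonal [u = v] missing from [Q]. *)
Lemma Q_prime_power_convolution (p r n : nat) : prime p -> 2 < p ^ r ->
  Q (p ^ r) n + odd_multiple (p ^ r) n =
  \sum_(k < n.+1) odd_multiple 1 k * odd_multiple (p ^ r).-1 (n - k).
Proof.
move=> pp q2; set q := p ^ r.
transitivity (\sum_(i < uphalf n) \sum_(j < uphalf n) (odd_pair_size q i j == n)).
  rewrite Q_prime_power_ordered_pairs //.
  rewrite -(@sum_odd_multiples q n (uphalf n)) -?big_split; [|lia|] => //=.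
  apply: eq_bigr => i _; rewrite (bigD1 i) // [RHS](bigD1 i) //= eqxx add0n addnC.
  congr (_ + _); first by congr nat_of_bool; rewrite /odd_pair_size; nia.
  by apply: eq_bigr => j; rewrite eq_sym => ->.
under eq_bigr do under eq_bigr do rewrite eqn_add_sum.
under eq_bigr do rewrite exchange_big /=.
rewrite exchange_big /=; apply: eq_bigr => k _; have kn : k <= n by rewrite -ltnS.
rewrite -(@sum_odd_multiples 1 k (uphalf n)) //; last by lia.
rewrite -(@sum_odd_multiples q.-1 (n - k) (uphalf n)); [|lia|lia].
rewrite big_distrlr /=; apply: eq_bigr => i _; apply: eq_bigr => j _.
by rewrite mul1n.
Qed.

Local Open Scope classical_set_scope.
Local Open Scope ring_scope.

Definition cauchy_product (R : pzRingType) (a b : R ^nat) : R ^nat :=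
  fun n => \sum_(k < n.+1) a k * b (n - k)%N.

Lemma series_cauchy_product (R : pzRingType) (a b : R ^nat) (n : nat) :
  series (cauchy_product a b) n = \sum_(i < n) a i * series b (n - i)%N.
Proof.
elim: n => [|n IH]; first by rewrite /series /= !big_mkord !big_ord0.
rewrite seriesSr IH [RHS](eq_bigr (fun i : 'I_n.+1 =>
  a i * series b (n - i)%N + a i * b (n - i)%N)) => [|i _]; last first.
  by rewrite subSn ?seriesSr ?mulrDr // -ltnS.
rewrite big_split big_ord_recr /= subnn.
by rewrite [series b 0]/series /= big_nil mulr0 addr0.
Qed.

Lemma series_mul_subr_cauchy_product (R : pzRingType) (a b : R ^nat) (n : nat) :
  series a n * series b n - series (cauchy_product a b) n =
  \sum_(i < n) \sum_(n - i <= j < n) a i * b j.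
Proof.
rewrite series_cauchy_product [series a n]/series /= big_mkord mulr_suml -sumrB.
apply: eq_bigr => i _.
by rewrite -mulrBr sub_series_geq ?leq_subr // mulr_sumr.
Qed.

Lemma series_cauchy_product_ge (K : numDomainType) (a b : K ^nat) (m n : nat) :
  (forall i, 0 <= a i) -> (forall i, 0 <= b i) -> (m.*2 <= n)%N ->
  series a m * series b m <= series (cauchy_product a b) n.
Proof.
move=> a0 b0 mn; have le_mn : (m <= n)%N by lia.
have series_ge0 k : 0 <= series b k by exact: sumr_ge0.
rewrite series_cauchy_product [series a m]/series /= big_mkord mulr_suml.
rewrite (big_ord_widen n (fun i => a i * series b m)) // big_mkcond /=.
apply: ler_sum => i _; case: ifP => im; last by rewrite mulr_ge0.
rewrite ler_wpM2l // -subr_ge0 sub_series_geq; last by lia.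
exact: sumr_ge0.
Qed.

Lemma norm_series_mul_subr_cauchy_product (K : numFieldType) (a b : K ^nat) (n : nat) :
  `|series a n * series b n - series (cauchy_product a b) n| <=
  [normed series a] n * [normed series b] n -
  series (cauchy_product (fun i => `|a i|) (fun j => `|b j|)) n.
Proof.
rewrite !series_mul_subr_cauchy_product; apply: le_trans (ler_norm_sum _ _ _) _.
apply: ler_sum => i _; apply: le_trans (ler_norm_sum _ _ _) _.
by under eq_bigr do rewrite normrM.
Qed.

Lemma dominated_cvgr0 (K : numFieldType) (V : pseudoMetricNormedZmodType K)
    (T : Type) (F : set_system T) (FF : Filter F) (f : T -> V) (g : T -> K) :
  g @ F --> 0 -> (forall t, `|f t| <= g t) -> f @ F --> 0.
Proof.
move=> /cvgr0Pnorm_lt g0 fg; apply/cvgr0Pnorm_lt => e e0.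
apply: filterS (g0 e e0) => t; apply: le_lt_trans.
by rewrite (le_trans (fg t)) // real_ler_norm // ger0_real // (le_trans _ (fg t)).
Qed.

Lemma cvg_half : half @ \oo --> \oo.
Proof.
apply/cvgnyPge => A; near=> n.
have : (A.*2 <= n)%N by near: n; exact: nbhs_infty_ge.
by lia.
Unshelve. all: by end_near. Qed.

(* The products [a i * b j] with [i, j < n <= i + j] lie outside the square of side
   [n./2], so their sum is dominated by the difference of two convergent squares. *)
Lemma cvg_series_cauchy_product (K : numFieldType) (a b : K ^nat) (A B : K) :
  series a @ \oo --> A -> series b @ \oo --> B ->
  cvgn [normed series a] -> cvgn [normed series b] ->
  series (cauchy_product a b) @ \oo --> A * B.
Proof.
move=> aA bB /cvg_ex[/= A' aA'] /cvg_ex[/= B' bB'].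
pose square n := [normed series a] n * [normed series b] n.
have square_cvg : square @ \oo --> A' * B' by exact: cvgM.
have shell_cvg : (fun n => square n - square n./2) @ \oo --> (0 : K).
  rewrite -(subrr (A' * B')); apply: cvgB => //.
  exact: (cvg_comp _ _ cvg_half).
apply: cvg_sub0 (cvgM aA bB); apply: dominated_cvgr0 shell_cvg _ => n /=.
rewrite distrC; apply: le_trans (norm_series_mul_subr_cauchy_product _ _ _) _.
by rewrite lerD2l lerN2; apply: series_cauchy_product_ge => //=; lia.
Qed.

Lemma cvg_series_quasiperiodic (K : numFieldType) (a : K ^nat) (c : K) (m : nat) :
  (forall n, a (n + m)%N = c * a n) -> c != 1 -> a @ \oo --> 0 ->
  series a @ \oo --> series a m / (1 - c).
Proof.
move=> ac c1 a0; have c1_neq0 : 1 - c != 0 by rewrite subr_eq0 eq_sym.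
set block := series a m; pose window n := \sum_(k < m) a (n + k)%N.
have window_cvg : window @ \oo --> (0 : K).
  have -> : 0 = \sum_(k < m) 0 :> K by rewrite big1.
  apply: cvg_big => [|k _]; first exact: add_continuous.
  by rewrite (cvg_shiftn k).
have windowE n : series a n + window n = block + c * series a n.
  transitivity (series a (n + m)%N).
    rewrite addnC series_addn -[X in index_iota X]add0n big_addn addnK big_mkord.
    by under [X in _ = _ + X]eq_bigr do rewrite addnC.
  rewrite series_addn -[X in index_iota X]add0n big_addn addnK mulr_sumr.
  by under eq_bigr do rewrite ac.
have seriesE n : series a n = (block - window n) / (1 - c).
  apply: (canRL (mulfK c1_neq0)).
  by rewrite -[block](addrK (c * series a n)) -windowE; ring.
rewrite (funext seriesE) -[X in X / _]subr0.
by apply: cvgMr_tmp; apply: cvgB window_cvg; exact: cvg_cst.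
Qed.

Definition odd_powers (R : pzRingType) (x : R) (d : nat) : R ^nat :=
  fun n => (odd_multiple d n)%:R * x ^+ n.

Lemma odd_powersDl (R : comPzRingType) (x : R) (d n : nat) : (0 < d)%N ->
  odd_powers x d (n + 2 * d) = x ^+ (2 * d) * odd_powers x d n.
Proof. by move=> d0; rewrite /odd_powers odd_multipleDl // exprD mulrA mulrC. Qed.

Lemma series_odd_powers (R : pzRingType) (x : R) (d : nat) : (0 < d)%N ->
  series (odd_powers x d) (2 * d) = x ^+ d.
Proof.
move=> d0; have d2 : (d < 2 * d)%N by lia.
rewrite /series /= big_mkord (bigD1 (Ordinal d2)) //= big1 => [|i].
  by rewrite /odd_powers odd_multiple_lt // eqxx mul1r addr0.
by rewrite -val_eqE /odd_powers odd_multiple_lt //= => /negPf ->; rewrite mul0r.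
Qed.

Section OddPowersSeries.

Variables (K : numFieldType) (x : K).
Hypothesis expr_cvg0 : x ^+ n @[n --> \oo] --> 0.

Lemma normr_expr_cvg0 : `|x| ^+ n @[n --> \oo] --> 0.
Proof. by under eq_fun do rewrite -normrX; apply/norm_cvg0P. Qed.

Lemma expr_cvg0_normr_lt1 : `|x| < 1.
Proof.
move/cvgr0Pnorm_lt: expr_cvg0 => /(_ 1 ltr01) expr_lt1_near; near \oo => n.
rewrite -(@expr_lt1 _ n) //; first by rewrite -normrX; near: n.
by near: n; exact: nbhs_infty_gt.
Unshelve. all: by end_near. Qed.

Lemma cvg_series_odd_powers (d : nat) : (0 < d)%N ->
  series (odd_powers x d) @ \oo --> x ^+ d / (1 - x ^+ (2 * d)).
Proof.
move=> d0; rewrite -(series_odd_powers x d0).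
apply: cvg_series_quasiperiodic => [n||]; first exact: odd_powersDl.
  apply: contraTneq expr_cvg0_normr_lt1 => /(congr1 Num.norm)/eqP.
  rewrite normrX normr1 pexpr_eq1 //; last by lia.
  by move/eqP->; rewrite ltxx.
apply: dominated_cvgr0 normr_expr_cvg0 _ => n.
by rewrite normrM normrX normr_nat ler_piMl ?exprn_ge0 // lern1 leq_b1.
Qed.

End OddPowersSeries.

Lemma is_cvg_normed_series_odd_powers (K : numFieldType) (x : K) (d : nat) :
  x ^+ n @[n --> \oo] --> 0 -> (0 < d)%N -> cvgn [normed series (odd_powers x d)].
Proof.
move=> xn0 d0; rewrite (_ : [normed series _] = series (odd_powers `|x| d)).
  by apply/cvg_ex; eexists; apply: cvg_series_odd_powers d0; exact: normr_expr_cvg0.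
by congr series; apply/funext => n; rewrite /odd_powers /= normrM normrX normr_nat.
Qed.

(* Norms in [R[i]] are themselves complex numbers, so the real limit has to be
   transported along [%:C]. *)
Lemma cvg_expr0_complex (R : realType) (x : R[i]^o) : `|x| < 1 ->
  (fun n => x ^+ n : R[i]^o) @ \oo --> (0 : R[i]^o).
Proof.
move=> x1; have [y yE] : exists y : R, `|x| = (y%:C)%C.
  by apply/complex_realP; exact: normr_real.
have y0 : 0 <= y by rewrite -ler0c -yE.
have y1 : `|y| < 1 by rewrite ger0_norm // -ltcR -yE.
apply/cvgr0Pnorm_lt => e e0.
have [e' eE] : exists e' : R, e = (e'%:C)%C by apply/complex_realP; rewrite realE ltW.
have /cvgr0Pnorm_lt/(_ e') := cvg_geometric 1 y1.
rewrite eE ltcR in e0 *; move=> /(_ e0); apply: filterS => n /=.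
by rewrite mul1r !normrX (ger0_norm y0) yE -rmorphXn ltcR.
Qed.

Lemma Q_prime_power_term (R : comPzRingType) (x : R) (p r n : nat) :
  prime p -> (2 < p ^ r)%N ->
  (Q (p ^ r) n)%:R * x ^+ n =
  cauchy_product (odd_powers x 1) (odd_powers x (p ^ r).-1) n - odd_powers x (p ^ r) n.
Proof.
move=> pp q2; apply/eqP; rewrite -subr_eq opprK -mulrDl -natrD.
rewrite Q_prime_power_convolution // natr_sum mulr_suml; apply/eqP/eq_bigr => k _.
by rewrite /odd_powers mulrACA -exprD (subnKC (leq_ord k)) natrM.
Qed.

Lemma sum_Q_prime_power (R : comPzRingType) (x : R) (p r N : nat) :
  prime p -> (2 < p ^ r)%N ->
  \sum_(1 <= n < N) (Q (p ^ r) n)%:R * x ^+ n =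
  series (cauchy_product (odd_powers x 1) (odd_powers x (p ^ r).-1)) N
  - series (odd_powers x (p ^ r)) N.
Proof.
move=> pp q2; have Q0 : Q (p ^ r) 0 = 0%N.
  have /eqP := Q_prime_power_convolution 0 pp q2.
  by rewrite big_ord1 mul0n addn_eq0 => /andP[/eqP].
transitivity (\sum_(0 <= n < N) (Q (p ^ r) n)%:R * x ^+ n).
  case: N => [|N]; first by rewrite !big_geq.
  by rewrite [RHS]big_ltn // Q0 mul0r add0r.
by rewrite /series /= -sumrB; apply: eq_bigr => n _; exact: Q_prime_power_term.
Qed.

Theorem theorem2 (R : realType) (p r : nat) (x : R[i]^o)
    (hp : prime p) (hr : (0 < r)%N) (hpr : (2 < p ^ r)%N) (hx : `|x| < 1) :
  (fun N : nat => \sum_(1 <= n < N) (Q (p ^ r) n)%:R * x ^+ n) @ \oo -->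
    x ^+ (p ^ r) / ((1 - x ^+ 2) * (1 - x ^+ (2 * (p ^ r - 1))))
    - x ^+ (p ^ r) / (1 - x ^+ (2 * p ^ r)).
Proof.
have expr_cvg0 := cvg_expr0_complex hx.
under eq_fun do rewrite (sum_Q_prime_power _ _ hp hpr).
set q := (p ^ r)%N.
have q_gt0 : (0 < q)%N by exact: ltn_trans hpr.
have q1_gt0 : (0 < q.-1)%N by rewrite -subn1 subn_gt0 (ltn_trans _ hpr).
apply: cvgB; last exact: cvg_series_odd_powers.
have -> : x ^+ q / ((1 - x ^+ 2) * (1 - x ^+ (2 * (q - 1)))) =
    x ^+ 1 / (1 - x ^+ (2 * 1)) * (x ^+ q.-1 / (1 - x ^+ (2 * q.-1))).
  by rewrite mulf_div -exprD add1n prednK // subn1.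
apply: cvg_series_cauchy_product.
- exact: cvg_series_odd_powers.
- exact: cvg_series_odd_powers.
- exact: is_cvg_normed_series_odd_powers.
- exact: is_cvg_normed_series_odd_powers.
Qed.
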